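(* Let $M$ be a finitely generated commutative monoid. There is an equivalence of categories $\mathcal{H}(M)\simeq\mathcal{H}(\mathsf{Spec}(M))$, where $\mathsf{Spec}(M)$ denotes the affine monoid scheme of $M$.
   Context: **Systems over a monoid.** All monoids are commutative, written multiplicatively with unit $1$. A system of abelian groups $\mathcal{A}$ over $M$ consists of an abelian group $\mathcal{A}(a)$ for each $a\in M$ and homomorphisms $r_*:\mathcal{A}(a)\to\mathcal{A}(ra)$ for all $r,a\in M$ with $1_*=\mathrm{id}$ and $(rs)_*=r_*\circ s_*$. A morphism is a family of homomorphisms $\mathcal{A}(a)\to\mathcal{B}(a)$ commuting with all $r_*$; the category is $\mathcal{H}(M)$. A monoid homomorphism $\varphi:M\to N$ gives $\varphi^*:\mathcal{H}(N)\to\mathcal{H}(M)$, $(\varphi^*\mathcal{A}')(a)=\mathcal{A}'(\varphi(a))$, with $r_*$ given by $\varphi(r)_*$. For a localisation $i_S:M\to S^{-1}M$ at a submonoid $S$, the functor $i_S^*$ has a left adjoint $i^S_!$, the localisation $\mathcal{A}\mapsto S^{-1}\mathcal{A}$: $(S^{-1}\mathcal{A})(\frac as)$ consists of classes of fractions $\frac{x}{ss'}$ with $s'\in S$, $x\in\mathcal{A}(as')$, where $\frac{x_1}{ss_1'}=\frac{x_2}{ss_2'}$ iff $(s_2'u)_*(x_1)=(s_1'u)_*(x_2)$ for some $u\in S$, and $(\frac bt)_*(\frac{x}{ss'})=\frac{b_*(x)}{sts'}$. **The affine scheme.** A prime ideal of $M$ is a (possibly empty) subset $\mathfrak{p}$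 with $M\mathfrak{p}\subseteq\mathfrak{p}$, $1\notin\mathfrak{p}$, and $ab\in\mathfrak{p}$, $b\notin\mathfrak{p}$ imply $a\in\mathfrak{p}$. The affine monoid scheme $X=\mathsf{Spec}(M)$ is the poset of prime ideals ordered by inclusion with the structure sheaf $\mathcal{O}_{X,\mathfrak{p}}=M_{\mathfrak{p}}=(M\setminus\mathfrak{p})^{-1}M$ and, for $\mathfrak{q}\subseteq\mathfrak{p}$, the localisation maps $i^{\mathfrak{p},\mathfrak{q}}:M_{\mathfrak{p}}\to M_{\mathfrak{q}}$. **Systems over a monoid scheme $X$.** An object of $\mathcal{H}(X)$ is a family $\mathcal{A}_x\in\mathcal{H}(\mathcal{O}_{X,x})$, $x\in X$, with morphisms $\alpha_{x,y}:\mathcal{A}_x\to(i^{x,y})^*\mathcal{A}_y$ for $y\le x$, such that $\alpha_{x,x}=\mathrm{id}$, $\alpha_{x,z}=(i^{x,y})^*(\alpha_{y,z})\circ\alpha_{x,y}$ for $z\le y\le x$, and each adjoint morphism $\alpha^{x,y}:i^{x,y}_!\mathcal{A}_x\to\mathcal{A}_y$ is an isomorphism in $\mathcal{H}(\mathcal{O}_{X,y})$. Morphisms are families of morphisms $\mathcal{A}_x\to\mathcal{B}_x$ in $\mathcal{H}(\mathcal{O}_{X,x})$ compatible with the $\alpha_{x,y}$. *)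

(* Defs.v *)
From HB Require Import structures.
From mathcomp Require Import all_boot order ssralg generic_quotient.
From mathcomp Require Import boolp classical_sets.

Set Implicit Arguments.
Unset Strict Implicit.
Unset Printing Implicit Defensive.

Import Order.TTheory GRing.Theory.

Local Open Scope quotient_scope.
Local Open Scope group_scope.

Record category := Category {
  obj :> Type;
  hom : obj -> obj -> Type;
  idm : forall X, hom X X;
  comp : forall X Y Z, hom Y Z -> hom X Y -> hom X Z;
  comp_idl : forall X Y (f : hom X Y), comp (idm Y) f = f;
  comp_idr : forall X Y (f : hom X Y), comp f (idm X) = f;
  compA : forall X Y Z T (h : hom Z T) (g : hom Y Z) (f : hom X Y),
    comp h (comp g f) = comp (comp h g) f }.

Arguments idm {c} X.

Definition is_iso (C : category) (X Y : C) (f : hom X Y) : Prop :=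
  exists g : hom Y X, comp g f = idm X /\ comp f g = idm Y.

Record functor (C D : category) := Functor {
  fobj :> C -> D;
  fmap : forall X Y : C, hom X Y -> hom (fobj X) (fobj Y);
  fmap_id : forall X, fmap (idm X) = idm (fobj X);
  fmap_comp : forall (X Y Z : C) (g : hom Y Z) (f : hom X Y),
    fmap (comp g f) = comp (fmap g) (fmap f) }.

Definition functor_id (C : category) : functor C C :=
  @Functor C C id (fun _ _ f => f) (fun _ => erefl) (fun _ _ _ _ _ => erefl).

Lemma functor_comp_id (C D E : category) (G : functor D E) (F : functor C D) X :
  fmap G (fmap F (idm X)) = idm (G (F X)).
Proof. by rewrite !fmap_id. Qed.

Lemma functor_comp_comp (C D E : category) (G : functor D E) (F : functor C D)
    (X Y Z : C) (g : hom Y Z) (f : hom X Y) :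
  fmap G (fmap F (comp g f)) = comp (fmap G (fmap F g)) (fmap G (fmap F f)).
Proof. by rewrite !fmap_comp. Qed.

Definition functor_comp (C D E : category) (G : functor D E) (F : functor C D) :
    functor C E :=
  @Functor C E (fun X => G (F X)) (fun _ _ f => fmap G (fmap F f))
    (functor_comp_id G F) (functor_comp_comp G F).

Definition nat_isomorphic (C D : category) (F G : functor C D) : Prop :=
  exists eta : forall X, hom (F X) (G X),
    (forall X, is_iso (eta X)) /\
    (forall X Y (f : hom X Y), comp (eta Y) (fmap F f) = comp (fmap G f) (eta X)).

Definition equivalent (C D : category) : Prop :=
  exists (F : functor C D) (G : functor D C),
    nat_isomorphic (functor_comp G F) (functor_id C) /\
    nat_isomorphic (functor_comp F G) (functor_id D).

HB.mixin Record Monoid_isCommutative M of Monoid M := {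
  mulgC : commutative (@monoid.mul M)
}.

#[short(type="comMonoidType")]
HB.structure Definition ComMonoid := {M of Monoid_isCommutative M & Monoid M}.

HB.instance Definition _ (M : comMonoidType) :=
  SemiGroup.isCommutativeLaw.Build M *%g mulgC.

Lemma mulgCA (M : comMonoidType) : left_commutative (@monoid.mul M).
Proof. exact: Monoid.mulmCA. Qed.

Lemma mulgAC (M : comMonoidType) : right_commutative (@monoid.mul M).
Proof. exact: Monoid.mulmAC. Qed.

Lemma mulgACA (M : comMonoidType) : interchange (@monoid.mul M) *%g.
Proof. exact: Monoid.mulmACA. Qed.

Record submonoid (M : comMonoidType) := Submonoid {
  submonoid_set :> M -> Prop;
  submonoid1 : submonoid_set 1;
  submonoidM : forall s t,
    submonoid_set s -> submonoid_set t -> submonoid_set (s * t) }.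

Definition finitely_generated (M : comMonoidType) : Prop :=
  exists gens : seq M, forall S : submonoid M,
    {in gens, forall a, S a} -> forall a, S a.

Section Localisation.

Variables (M : comMonoidType) (S : submonoid M).
Implicit Types s t : @set_type M S.

Definition den1 : @set_type M S := exist _ 1 (mem_set (submonoid1 S)).

Definition denM s t : @set_type M S :=
  exist _ (val s * val t) (mem_set (submonoidM (set_valP s) (set_valP t))).

Definition frac_rel (x y : M * @set_type M S) : bool :=
  `[< exists2 u, S u & u * (val y.2 * x.1) = u * (val x.2 * y.1) >].

Lemma frac_rel_refl : reflexive frac_rel.
Proof. by move=> x; apply/asboolP; exists 1 => //; apply: submonoid1. Qed.

Lemma frac_rel_sym : symmetric frac_rel.
Proof.
by move=> x y; apply/asboolP/asboolP => -[u Su e]; exists u.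
Qed.

Lemma frac_rel_trans : transitive frac_rel.
Proof.
move=> [a2 s2] [a1 s1] [a3 s3] /asboolP[u Su /= e] /asboolP[v Sv /= f].
apply/asboolP; exists (u * v * val s2) => /=.
  by apply: submonoidM; [exact: submonoidM|exact: set_valP].
transitivity (v * val s3 * (u * (val s2 * a1))).
  by rewrite [LHS](AC (3*2) (2*4*(1*(3*5)))).
rewrite e; transitivity (u * val s1 * (v * (val s3 * a2))).
  by rewrite [LHS](AC (2*(1*2)) ((3*4)*(1*(2*5)))).
by rewrite f [LHS](AC (2*(1*2)) (1*3*4*(2*5))).
Qed.

Canonical frac_equiv := EquivRel frac_rel frac_rel_refl frac_rel_sym frac_rel_trans.

Definition loc := {eq_quot frac_rel}.
HB.instance Definition _ := Choice.on loc.

Definition frac (a : M) s : loc := \pi_{eq_quot frac_rel} (a, s).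

Lemma fracE a s b t : frac a s = frac b t <->
  exists2 u, S u & u * (val t * a) = u * (val s * b).
Proof.
rewrite /frac; split=> [/eqquotP/asboolP//|h].
by apply/eqquotP/asboolP.
Qed.

Lemma fracW (P : loc -> Prop) : (forall a s, P (frac a s)) -> forall z, P z.
Proof. by move=> h z; rewrite -[z]reprK; case: (repr z). Qed.

Definition loc_one : loc := frac 1 den1.

Definition loc_mul (x y : loc) : loc :=
  frac ((repr x).1 * (repr y).1) (denM (repr x).2 (repr y).2).

Lemma repr_frac a s : exists2 u, S u &
  u * (val s * (repr (frac a s)).1) = u * (val (repr (frac a s)).2 * a).
Proof. by apply/fracE; rewrite /frac -surjective_pairing reprK. Qed.

Lemma frac_mul a s b t :
  loc_mul (frac a s) (frac b t) = frac (a * b) (denM s t).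
Proof.
have [u Su e] := repr_frac a s; have [v Sv f] := repr_frac b t.
apply/fracE; exists (u * v); first exact: submonoidM.
move: (repr (frac a s)) (repr (frac b t)) e f => [a' s'] [b' t'] /= e f.
rewrite [LHS](AC (2*(2*2)) ((1*(3*5))*(2*(4*6)))) /= e f.
by rewrite [LHS](AC ((1*2)*(1*2)) ((1*4)*((2*5)*(3*6)))).
Qed.

Fact loc_mulA : associative loc_mul.
Proof.
elim/fracW=> a s; elim/fracW=> b t; elim/fracW=> c r.
rewrite !frac_mul mulgA; congr frac.
by apply/val_inj; rewrite /= mulgA.
Qed.

Fact loc_mulC : commutative loc_mul.
Proof.
elim/fracW=> a s; elim/fracW=> b t; rewrite !frac_mul mulgC; congr frac.
by apply/val_inj; rewrite /= mulgC.
Qed.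

Fact loc_mul1 : left_id loc_one loc_mul.
Proof.
elim/fracW=> a s; rewrite frac_mul mul1g; congr frac.
by apply/val_inj; rewrite /= mul1g.
Qed.

Fact loc_mulr1 : right_id loc_one loc_mul.
Proof. by move=> x; rewrite loc_mulC loc_mul1. Qed.

HB.instance Definition _ := isMonoid.Build loc loc_mulA loc_mul1 loc_mulr1.
HB.instance Definition _ := Monoid_isCommutative.Build loc loc_mulC.

Lemma fracM a s b t : frac a s * frac b t = frac (a * b) (denM s t).
Proof. exact: frac_mul. Qed.

Lemma frac_same s : frac (val s) s = 1.
Proof.
apply/(fracE (val s) s 1 den1); exists 1; first exact: submonoid1.
by rewrite /= !mul1g mulg1.
Qed.

Definition to_loc (a : M) : loc := frac a den1.

Fact to_loc_morphism : monoid.monoid_morphism to_loc.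
Proof.
split=> // a b; rewrite fracM; congr frac.
by apply/val_inj; rewrite /= mul1g.
Qed.
HB.instance Definition _ := isUMagmaMorphism.Build M loc to_loc to_loc_morphism.

Lemma frac_to_loc a s : to_loc (val s) * frac a s = to_loc a.
Proof.
rewrite fracM; apply/fracE; exists 1; first exact: submonoid1.
by rewrite /= !mul1g.
Qed.

End Localisation.

(** [i : M -> N] presents [N] as a localisation of [M] at [S]. Besides
    [to_loc S] this covers the maps [M_p -> M_q] below, whose target is built
    from [M] and not from [M_p]. *)
Record is_localisation (M N : comMonoidType) (S : submonoid M)
    (i : UMagmaMorphism.type M N) : Prop := IsLocalisation {
  loc_unit : forall s, S s -> exists n, n * i s = 1;
  loc_surj : forall n, exists a s, S s /\ i s * n = i a;
  loc_eq : forall a b, i a = i b -> exists2 u, S u & u * a = u * b }.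

Lemma to_loc_localisation (M : comMonoidType) (S : submonoid M) :
  is_localisation S (to_loc S).
Proof.
split.
- move=> s Ss.
  exists (frac 1 (exist _ s (mem_set Ss) : @set_type M S)).
  rewrite mulgC -[s]/(val (exist _ s (mem_set Ss) : @set_type M S)).
  by rewrite frac_to_loc gmulf1.
- by elim/fracW=> a s; exists a, (val s); split; [exact: set_valP|exact: frac_to_loc].
- by move=> a b /fracE[u Su]; rewrite /= !mul1g; exists u.
Qed.

Section LocalisationMap.

Variables (M : comMonoidType) (S T : submonoid M).
Hypothesis ST : forall s, S s -> T s.

Definition den_incl (s : @set_type M S) : @set_type M T :=
  exist _ (val s) (mem_set (ST (set_valP s))).

Definition loc_map (x : loc S) : loc T := frac (repr x).1 (den_incl (repr x).2).

Lemma loc_map_frac a s : loc_map (frac a s) = frac a (den_incl s).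
Proof.
by have [u Su e] := repr_frac a s; apply/fracE; exists u => //; apply: ST.
Qed.

Fact loc_map_morphism : monoid.monoid_morphism loc_map.
Proof.
split=> [|x y].
  by rewrite [LHS]loc_map_frac; congr frac; apply/val_inj.
elim/fracW: x => a s; elim/fracW: y => b t.
rewrite fracM !loc_map_frac fracM; congr frac.
exact/val_inj.
Qed.
HB.instance Definition _ :=
  isUMagmaMorphism.Build (loc S) (loc T) loc_map loc_map_morphism.

Definition loc_den_set : set (loc S) := [set x | exists2 t, T t & x = to_loc S t]%classic.

Fact loc_den_set1 : loc_den_set 1.
Proof. by exists 1; [exact: submonoid1 | rewrite gmulf1]. Qed.

Fact loc_den_setM x y : loc_den_set x -> loc_den_set y -> loc_den_set (x * y).
Proof.
move=> [s Ts ->] [t Tt ->].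
by exists (s * t); [exact: submonoidM | rewrite gmulfM].
Qed.

Definition loc_den : submonoid (loc S) := Submonoid loc_den_set1 loc_den_setM.

Lemma loc_map_to_loc a : loc_map (to_loc S a) = to_loc T a.
Proof. by rewrite loc_map_frac; congr frac; apply/val_inj. Qed.

Lemma loc_map_localisation : is_localisation loc_den loc_map.
Proof.
split.
- move=> _ [t Tt ->]; rewrite /= loc_map_to_loc.
  exact: loc_unit (to_loc_localisation T) _ Tt.
- move=> n; have [a [t [Tt e]]] := loc_surj (to_loc_localisation T) n.
  exists (to_loc S a), (to_loc S t); split; first by exists t.
  by rewrite /= !loc_map_to_loc.
- elim/fracW=> a s; elim/fracW=> b t; rewrite /= !loc_map_frac.
  move=> /fracE[u Tu /= e]; exists (to_loc S u); first by exists u.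
  rewrite !fracM; apply/fracE; exists 1; first exact: submonoid1.
  by rewrite /= !mul1g mulgCA e mulgCA.
Qed.

End LocalisationMap.

Record is_prime_ideal (M : comMonoidType) (p : set M) : Prop := IsPrimeIdeal {
  ideal_mul : forall a x, p x -> p (a * x);
  ideal_proper : ~ p 1;
  ideal_prime : forall a b, p (a * b) -> ~ p b -> p a }.

Record prime_ideal (M : comMonoidType) := PrimeIdeal {
  ideal_set :> set M;
  prime_idealP : `[< is_prime_ideal ideal_set >] }.

HB.instance Definition _ (M : comMonoidType) := [isSub for @ideal_set M].
HB.instance Definition _ (M : comMonoidType) := [Choice of prime_ideal M by <:].

Fact spec_display : Order.disp_t. Proof. exact: Order.Disp tt tt. Qed.

HB.instance Definition _ (M : comMonoidType) :=
  [SubChoice_isSubPOrder of prime_ideal M by <: with spec_display].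

Record system (M : comMonoidType) := System {
  sys :> M -> zmodType;
  act : forall r a : M, {additive sys a -> sys (r * a)%g};
  act1 : forall a (x : sys a), act 1 a x = ecast b (sys b) (esym (mul1g a)) x;
  actM : forall r s a (x : sys a),
    act (r * s) a x = ecast b (sys b) (mulgA r s a) (act r (s * a) (act s a x)) }.

Record sys_hom (M : comMonoidType) (A B : system M) := SysHom {
  sys_map :> forall a, {additive A a -> B a};
  sys_map_act : forall r a (x : A a),
    sys_map (r * a) (act A r a x) = act B r a (sys_map a x) }.

Lemma additive_ext (U V : zmodType) (f g : {additive U -> V}) : f =1 g -> f = g.
Proof.
case: f g => [f [[Hf]]] [g [[Hg]]] /= /funext fg; subst g.
by rewrite (Prop_irrelevance Hf Hg).
Qed.

Lemma sys_hom_ext (M : comMonoidType) (A B : system M) (f g : sys_hom A B) :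
  (forall a x, f a x = g a x) -> f = g.
Proof.
case: f g => [f Hf] [g Hg] /= fg.
have fgE : f = g.
  by apply: functional_extensionality_dep => a; apply: additive_ext => x; apply: fg.
by subst g; rewrite (Prop_irrelevance Hf Hg).
Qed.

Lemma ecastK (T : Type) (P : T -> Type) a b (e : a = b) (x : P b) :
  ecast c (P c) e (ecast c (P c) (esym e) x) = x.
Proof. by case: b / e x. Qed.

Lemma ecastVK (T : Type) (P : T -> Type) a b (e : a = b) (x : P a) :
  ecast c (P c) (esym e) (ecast c (P c) e x) = x.
Proof. by case: b / e. Qed.

(** [push e x] is [r_* x], read in [A b] along the equation [r * a = b]. *)
Definition push (M : comMonoidType) (A : system M) (r a b : M) (e : r * a = b)
  (x : A a) : A b := ecast c (A c) e (act A r a x).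

Section Push.

Variables (M : comMonoidType) (A : system M).
Implicit Types r s a b : M.

Fact push_additive r a b (e : r * a = b) : nmod_morphism (@push M A r a b e).
Proof. by case: b / e; split=> [|x y]; rewrite /push (raddf0, raddfD). Qed.
HB.instance Definition _ r a b (e : r * a = b) :=
  GRing.isNmodMorphism.Build (A a) (A b) (@push M A r a b e) (push_additive e).

Lemma push_erefl r a (x : A a) : push (erefl (r * a)) x = act A r a x.
Proof. by []. Qed.

Lemma push_eq r s a b (e : r * a = b) (e' : s * a = b) (x : A a) :
  r = s -> push e x = push e' x.
Proof. by move=> rs; subst s; rewrite (eq_irrelevance e e'). Qed.

Lemma push_cast a b (e : a = b) (e' : 1 * a = b) (x : A a) :
  ecast c (A c) e x = push e' x.
Proof.
case: b / e e' => e'; rewrite /push act1 /= (eq_irrelevance e' (mul1g a)).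
by rewrite ecastK.
Qed.

Lemma push1 a (e : 1 * a = a) (x : A a) : push e x = x.
Proof. by rewrite -(push_cast erefl). Qed.

Lemma push_push r s a b c (e1 : s * a = b) (e2 : r * b = c) (e : r * s * a = c)
  (x : A a) : push e2 (push e1 x) = push e x.
Proof.
case: b / e1 e2 => e2; case: c / e2 e => e.
by rewrite /push actM (eq_irrelevance e (esym (mulgA r s a))); case: _ / (mulgA r s a).
Qed.

Lemma push_comp r s t a b c (e1 : s * a = b) (e2 : r * b = c) (e : t * a = c)
  (x : A a) : r * s = t -> push e2 (push e1 x) = push e x.
Proof. by move=> rst; subst t; apply: push_push. Qed.

Lemma push_comm r s r' s' a b b' c (e1 : s * a = b) (e2 : r * b = c)
    (e1' : s' * a = b') (e2' : r' * b' = c) (x : A a) :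
  r * s = r' * s' -> push e2 (push e1 x) = push e2' (push e1' x).
Proof.
move=> rs; have e : r * s * a = c by rewrite -mulgA e1.
by rewrite (push_comp _ _ e) // (push_comp _ _ e).
Qed.

End Push.

Lemma sys_map_push (M : comMonoidType) (A B : system M) (f : sys_hom A B)
  r a b (e : r * a = b) (x : A a) : f b (push e x) = push e (f a x).
Proof. by case: b / e; rewrite /push /= sys_map_act. Qed.

Section SystemCategory.

Variable M : comMonoidType.

Definition sys_hom_id (A : system M) : sys_hom A A :=
  @SysHom M A A (fun a => idfun) (fun _ _ _ => erefl).

Fact sys_hom_comp_act (A B C : system M) (g : sys_hom B C) (f : sys_hom A B) r a
  (x : A a) : (g (r * a) \o f (r * a)) (act A r a x) = act C r a ((g a \o f a) x).
Proof. by rewrite /= !sys_map_act. Qed.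

Definition sys_hom_comp (A B C : system M) (g : sys_hom B C) (f : sys_hom A B) :
    sys_hom A C :=
  @SysHom M A C (fun a => g a \o f a) (sys_hom_comp_act g f).

Fact sys_hom_comp_idl (A B : system M) (f : sys_hom A B) :
  sys_hom_comp (sys_hom_id B) f = f.
Proof. exact: sys_hom_ext. Qed.

Fact sys_hom_comp_idr (A B : system M) (f : sys_hom A B) :
  sys_hom_comp f (sys_hom_id A) = f.
Proof. exact: sys_hom_ext. Qed.

Fact sys_hom_compA (A B C D : system M) (h : sys_hom C D) (g : sys_hom B C)
    (f : sys_hom A B) :
  sys_hom_comp h (sys_hom_comp g f) = sys_hom_comp (sys_hom_comp h g) f.
Proof. exact: sys_hom_ext. Qed.

Definition sys_cat : category :=
  Category sys_hom_comp_idl sys_hom_comp_idr sys_hom_compA.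

End SystemCategory.

Section Pullback.

Variables (M N : comMonoidType) (phi : UMagmaMorphism.type M N) (A : system N).

Definition pull_act r a : {additive A (phi a) -> A (phi (r * a)%g)} :=
  @push N A (phi r) (phi a) (phi (r * a)) (esym (gmulfM (s := phi) r a)).

Lemma pull_cast a b (e : a = b) (e' : 1 * phi a = phi b) (x : A (phi a)) :
  ecast c (A (phi c)) e x = push e' x.
Proof. by case: b / e e' => e'; rewrite push1. Qed.

Fact pull_act1 a (x : A (phi a)) :
  pull_act 1 a x = ecast b (A (phi b)) (esym (mul1g a)) x.
Proof.
have e : 1 * phi a = phi (1 * a) by rewrite !mul1g.
by rewrite (pull_cast _ e); apply: push_eq; apply: gmulf1.
Qed.

Fact pull_actM r s a (x : A (phi a)) :
  pull_act (r * s) a x =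
  ecast b (A (phi b)) (mulgA r s a) (pull_act r (s * a) (pull_act s a x)).
Proof.
have e : 1 * phi (r * (s * a)) = phi (r * s * a) by rewrite mul1g mulgA.
have e1 : phi r * phi s * phi a = phi (r * (s * a)) by rewrite !gmulfM mulgA.
have e2 : 1 * (phi r * phi s) * phi a = phi (r * s * a) by rewrite mul1g !gmulfM.
rewrite (pull_cast _ e) /= (push_push _ _ e1) (push_push _ _ e2).
by apply: push_eq; rewrite mul1g gmulfM.
Qed.

Definition pull : system M :=
  @System M (fun a => A (phi a)) pull_act pull_act1 pull_actM.

End Pullback.

Section PullbackMap.

Variables (M N : comMonoidType) (phi : UMagmaMorphism.type M N).
Variables (A B : system N) (f : sys_hom A B).

Fact pull_map_act r a (x : pull phi A a) :
  f (phi (r * a)) (act (pull phi A) r a x) = act (pull phi B) r a (f (phi a) x).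
Proof. exact: sys_map_push. Qed.

Definition pull_map : sys_hom (pull phi A) (pull phi B) :=
  @SysHom M (pull phi A) (pull phi B) (fun a => f (phi a)) pull_map_act.

End PullbackMap.

Section LocSystem.

Variables (M N : comMonoidType) (S : submonoid M) (i : UMagmaMorphism.type M N).
Hypothesis iP : is_localisation S i.
Variable A : system M.

(** A fraction [x / s] in degree [z = b / s], with [x] in [A b]. Writing
    [z = a / s0], [s = s0 s'] and [b = a s'] gives the fractions [x / (s0 s')]
    with [x] in [A (a s')]; recording only that [b / s = z] avoids choosing a
    numerator and a denominator of [z], and loses nothing, since any [b / s]
    can be expanded to one of that form. *)
Record sfrac (z : N) := SFrac {
  sdeg : M;
  sden : M;
  sden_in : S sden;
  sdegE : i sdeg = i sden * z;
  snum : A sdeg }.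

HB.instance Definition _ z := gen_eqMixin (sfrac z).
HB.instance Definition _ z := gen_choiceMixin (sfrac z).

(** [x1 / s1 = x2 / s2] iff [(u s2)_* x1 = (u s1)_* x2] for some [u] in [S];
    this includes the equality [c] of the degrees of both sides. *)
Definition sfrac_rel (z : N) (x y : sfrac z) : bool :=
  `[< exists u c (ex : u * sden y * sdeg x = c) (ey : u * sden x * sdeg y = c),
        S u /\ push ex (snum x) = push ey (snum y) >].

Lemma sfrac_rel_refl z : reflexive (@sfrac_rel z).
Proof.
move=> x; apply/asboolP; exists 1, (1 * sden x * sdeg x), erefl, erefl.
by split=> //; apply: submonoid1.
Qed.

Lemma sfrac_rel_sym z : symmetric (@sfrac_rel z).
Proof.
by move=> x y; apply/asboolP/asboolP => -[u [c [e [f [Su h]]]]];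
  exists u, c, f, e.
Qed.

Lemma sfrac_rel_intro z (x y : sfrac z) u r r' c
    (e : r * sdeg x = c) (f : r' * sdeg y = c) :
  S u -> r = u * sden y -> r' = u * sden x ->
  push e (snum x) = push f (snum y) -> sfrac_rel x y.
Proof.
move=> Su rE rE'; subst r r' => h.
by apply/asboolP; exists u, c, e, f.
Qed.

Lemma sfrac_rel_trans z : transitive (@sfrac_rel z).
Proof.
move=> y x t /asboolP[u [c [e [f [Su h]]]]] /asboolP[v [d [e' [f' [Sv h']]]]].
pose C := v * sden t * c.
have cC : v * sden t * c = C by [].
have dC : u * sden x * d = C by rewrite -e' mulgCA f.
have g : v * sden t * (u * sden y) * sdeg x = C by rewrite -mulgA e.
have g' : u * sden x * (v * sden y) * sdeg t = C by rewrite -mulgA f'.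
apply: (@sfrac_rel_intro _ _ _ (u * v * sden y) _ _ C g g').
- by apply: submonoidM; [exact: submonoidM|exact: sden_in].
- by rewrite [LHS](AC (2*2) ((3*1)*4*2)).
- by rewrite [LHS](AC (2*2) ((1*3)*4*2)).
rewrite -(push_comp e cC g) // h -(push_comp f' dC g') // -h'.
by apply: push_comm; rewrite mulgC.
Qed.

Canonical sfrac_equiv z := EquivRel (@sfrac_rel z)
  (@sfrac_rel_refl z) (@sfrac_rel_sym z) (@sfrac_rel_trans z).

Definition sloc (z : N) := {eq_quot (@sfrac_rel z)}.
HB.instance Definition _ z := Choice.on (sloc z).

Definition sfr z b s (Ss : S s) (e : i b = i s * z) (x : A b) : sloc z :=
  \pi_{eq_quot (@sfrac_rel z)} (SFrac Ss e x).

Lemma sfrP z (P : sloc z -> Prop) :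
  (forall b s (Ss : S s) (e : i b = i s * z) (x : A b), P (sfr Ss e x)) ->
  forall q, P q.
Proof. by move=> h q; rewrite -[q]reprK; case: (repr q). Qed.

Lemma sfrE z b s (Ss : S s) (e : i b = i s * z) (x : A b)
    b' s' (Ss' : S s') (e' : i b' = i s' * z) (x' : A b') :
  sfr Ss e x = sfr Ss' e' x' <->
  exists u c (f : u * s' * b = c) (f' : u * s * b' = c),
    S u /\ push f x = push f' x'.
Proof.
rewrite /sfr; split=> [/eqquotP/asboolP//|h].
by apply/eqquotP/asboolP.
Qed.

Lemma sfr_expand z b s (Ss : S s) (e : i b = i s * z) (x : A b) r b' s'
    (Ss' : S s') (e' : i b' = i s' * z) (f : r * b = b') :
  s' = r * s -> sfr Ss e x = sfr Ss' e' (push f x).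
Proof.
move=> s'E; have g : 1 * s' * b = s * b' by rewrite mul1g s'E -mulgA mulgCA f.
have g' : 1 * s * b' = s * b' by rewrite mul1g.
apply/sfrE; exists 1, (s * b'), g, g'; split; first exact: submonoid1.
by symmetry; apply: push_comp; rewrite !mul1g s'E mulgC.
Qed.

Lemma sfr_den z b s s' (Ss : S s) (Ss' : S s') (e : i b = i s * z)
    (e' : i b = i s' * z) (x : A b) :
  s = s' -> sfr Ss e x = sfr Ss' e' x.
Proof.
move=> ss; subst s'; rewrite (eq_irrelevance e' e).
by rewrite (Prop_irrelevance Ss' Ss).
Qed.

Lemma sfr_cast z z' (h : z = z') b s (Ss : S s) (e : i b = i s * z)
    (e' : i b = i s * z') (x : A b) :
  ecast w (sloc w) h (sfr Ss e x) = sfr Ss e' x.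
Proof. by case: z' / h e' => e'; apply: sfr_den. Qed.

Lemma common_den z (q q' : sloc z) : exists b s (Ss : S s) (e : i b = i s * z) x x',
  q = sfr Ss e x /\ q' = sfr Ss e x'.
Proof.
elim/sfrP: q => b s Ss e x; elim/sfrP: q' => b' s' Ss' e' x'.
have [|u Su h] := loc_eq iP (a := s' * b) (b := s * b').
  by rewrite !gmulfM e e' mulgCA.
have f : u * s' * b = u * (s' * b) by rewrite mulgA.
have f' : u * s * b' = u * (s' * b) by rewrite -mulgA h.
have St : S (u * s' * s) by do 2?apply: submonoidM.
have g : i (u * (s' * b)) = i (u * s' * s) * z.
  by rewrite !gmulfM e !mulgA.
exists (u * (s' * b)), (u * s' * s), St, g, (push f x), (push f' x'); split.
  exact: sfr_expand.
by apply: sfr_expand; rewrite mulgAC.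
Qed.

Lemma common_den3 z (q q' q'' : sloc z) :
  exists b s (Ss : S s) (e : i b = i s * z) x x' x'',
  [/\ q = sfr Ss e x, q' = sfr Ss e x' & q'' = sfr Ss e x''].
Proof.
have [b [s [Ss [e [x [x' [qE q'E]]]]]]] := common_den q q'.
elim/sfrP: q'' => b' s' Ss' e' y.
have [|u Su h] := loc_eq iP (a := s' * b) (b := s * b').
  by rewrite !gmulfM e e' mulgCA.
have f : u * s' * b = u * (s' * b) by rewrite mulgA.
have f' : u * s * b' = u * (s' * b) by rewrite -mulgA h.
have St : S (u * s' * s) by do 2?apply: submonoidM.
have g : i (u * (s' * b)) = i (u * s' * s) * z.
  by rewrite !gmulfM e !mulgA.
exists (u * (s' * b)), (u * s' * s), St, g.
exists (push f x), (push f x'), (push f' y); split.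
- by rewrite qE; apply: sfr_expand.
- by rewrite q'E; apply: sfr_expand.
- by apply: sfr_expand; rewrite mulgAC.
Qed.

Lemma sfrD_compat z b s (Ss : S s) (e : i b = i s * z) (x y : A b)
    b' s' (Ss' : S s') (e' : i b' = i s' * z) (x' y' : A b') :
  sfr Ss e x = sfr Ss' e' x' -> sfr Ss e y = sfr Ss' e' y' ->
  sfr Ss e (x + y)%R = sfr Ss' e' (x' + y')%R.
Proof.
move=> /sfrE[u [c [f [f' [Su h]]]]] /sfrE[v [d [g [g' [Sv k]]]]].
have uC : v * c = v * c by [].
have vC : u * d = v * c by rewrite -g -f -!mulgA mulgCA.
have k1 : u * v * s' * b = v * c by rewrite -f !mulgA [u * v]mulgC.
have k2 : u * v * s * b' = v * c by rewrite -f' !mulgA [u * v]mulgC.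
apply/sfrE; exists (u * v), (v * c), k1, k2; split; first exact: submonoidM.
rewrite !raddfD /= -(push_comp f uC k1); last by rewrite mulgA [v * u]mulgC.
rewrite -(push_comp g vC k1); last by rewrite mulgA.
rewrite h k; congr (_ + _)%R; apply: push_comp.
  by rewrite mulgA [v * u]mulgC.
by rewrite mulgA.
Qed.

Lemma sfr_map_compat (F : forall a, A a -> A a)
    (F_push : forall r a b (e : r * a = b) x, F b (push e x) = push e (F a x))
    z b s (Ss : S s) (e : i b = i s * z) (x : A b)
    b' s' (Ss' : S s') (e' : i b' = i s' * z) (x' : A b') :
  sfr Ss e x = sfr Ss' e' x' -> sfr Ss e (F b x) = sfr Ss' e' (F b' x').
Proof.
move=> /sfrE[u [c [f [f' [Su h]]]]]; apply/sfrE; exists u, c, f, f'.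
by rewrite -!F_push h.
Qed.

Lemma sadd_subproof z (q q' : sloc z) : exists p : sloc z,
  forall b s (Ss : S s) (e : i b = i s * z) x x',
  q = sfr Ss e x -> q' = sfr Ss e x' -> p = sfr Ss e (x + x')%R.
Proof.
have [b [s [Ss [e [x [x' [-> ->]]]]]]] := common_den q q'.
by exists (sfr Ss e (x + x')%R) => *; apply: sfrD_compat.
Qed.

Definition sadd z (q q' : sloc z) : sloc z := sval (cid (sadd_subproof q q')).

Lemma saddE z b s (Ss : S s) (e : i b = i s * z) (x x' : A b) :
  sadd (sfr Ss e x) (sfr Ss e x') = sfr Ss e (x + x')%R.
Proof. by rewrite /sadd; case: cid => p /= /(_ _ _ Ss e x x') ->. Qed.

Definition sopp z (q : sloc z) : sloc z :=
  sfr (sden_in (repr q)) (sdegE (repr q)) (- snum (repr q))%R.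

Lemma sfr_repr z (q : sloc z) :
  q = sfr (sden_in (repr q)) (sdegE (repr q)) (snum (repr q)).
Proof. by rewrite -{1}[q]reprK /sfr; case: (repr q). Qed.

Lemma soppE z b s (Ss : S s) (e : i b = i s * z) (x : A b) :
  sopp (sfr Ss e x) = sfr Ss e (- x)%R.
Proof.
apply: (@sfr_map_compat (fun a (y : A a) => (- y)%R)); last by rewrite -sfr_repr.
by move=> *; rewrite raddfN.
Qed.

Lemma szero_subproof z : exists p : sloc z,
  forall b s (Ss : S s) (e : i b = i s * z), p = sfr Ss e 0%R.
Proof.
have [b [s [Ss e]]] := loc_surj iP z.
exists (sfr Ss (esym e) 0%R) => b' s' Ss' e'.
have [|u Su h] := loc_eq iP (a := s' * b) (b := s * b').
  by rewrite !gmulfM -e e' mulgCA.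
apply/sfrE; exists u, (u * (s' * b)).
have f : u * s' * b = u * (s' * b) by rewrite mulgA.
have f' : u * s * b' = u * (s' * b) by rewrite -mulgA h.
by exists f, f'; rewrite !raddf0.
Qed.

Definition szero z : sloc z := sval (cid (szero_subproof z)).

Lemma szeroE z b s (Ss : S s) (e : i b = i s * z) : szero z = sfr Ss e 0%R.
Proof. by rewrite /szero; case: cid => p /= /(_ _ _ Ss e) ->. Qed.

Fact saddA z : associative (@sadd z).
Proof.
move=> p q r; have [b [s [Ss [e [x [x' [x'' [-> -> ->]]]]]]]] := common_den3 p q r.
by rewrite !saddE addrA.
Qed.

Fact saddC z : commutative (@sadd z).
Proof.
move=> p q; have [b [s [Ss [e [x [x' [-> ->]]]]]]] := common_den p q.
by rewrite !saddE addrC.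
Qed.

Fact sadd0 z : left_id (szero z) (@sadd z).
Proof. by elim/sfrP=> b s Ss e x; rewrite (szeroE Ss e) saddE add0r. Qed.

Fact saddN z : left_inverse (szero z) (@sopp z) (@sadd z).
Proof.
by elim/sfrP=> b s Ss e x; rewrite soppE (szeroE Ss e) saddE addNr.
Qed.

HB.instance Definition _ z := GRing.isZmodule.Build (sloc z)
  (@saddA z) (@saddC z) (@sadd0 z) (@saddN z).

Lemma sfrD z b s (Ss : S s) (e : i b = i s * z) (x x' : A b) :
  (sfr Ss e x + sfr Ss e x' = sfr Ss e (x + x'))%R.
Proof. exact: saddE. Qed.

Lemma sfr0 z b s (Ss : S s) (e : i b = i s * z) : sfr Ss e 0%R = 0%R.
Proof. by rewrite -[RHS]/(szero z) (szeroE Ss e). Qed.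

Lemma act_deg n z c r b s :
  i r * n = i c -> i b = i s * z -> i (c * b) = i (r * s) * (n * z).
Proof. by move=> h e; rewrite !gmulfM -h e mulgACA. Qed.

Lemma sact_compat n z c r (Sr : S r) (h : i r * n = i c)
    c' r' (Sr' : S r') (h' : i r' * n = i c')
    b s (Ss : S s) (e : i b = i s * z) (x : A b)
    b' s' (Ss' : S s') (e' : i b' = i s' * z) (x' : A b') :
  sfr Ss e x = sfr Ss' e' x' ->
  sfr (submonoidM Sr Ss) (act_deg h e) (act A c b x) =
  sfr (submonoidM Sr' Ss') (act_deg h' e') (act A c' b' x').
Proof.
move=> /sfrE[u [d [f [f' [Su k]]]]].
have [|v Sv hv] := loc_eq iP (a := r' * c) (b := r * c').
  by rewrite !gmulfM -h -h' mulgCA.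
pose D := v * (r' * c) * d.
have DE : v * (r' * c) * d = D by [].
have DE' : v * (r * c') * d = D by rewrite -hv.
have g : u * v * (r' * s') * (c * b) = D.
  by rewrite -DE -f [LHS](AC (2*2*2) ((2*(3*5))*((1*4)*6))).
have g' : u * v * (r * s) * (c' * b') = D.
  by rewrite -DE' -f' [LHS](AC (2*2*2) ((2*(3*5))*((1*4)*6))).
apply/sfrE; exists (u * v), D, g, g'; split; first exact: submonoidM.
rewrite -!push_erefl (push_comm _ _ f DE); last first.
  by rewrite [LHS](AC (2*2*1) ((2*(3*5))*(1*4))).
rewrite k; transitivity (push DE' (push f' x')).
  by apply: push_eq.
by apply: push_comm; rewrite [RHS](AC (2*2*1) ((2*(3*5))*(1*4))).
Qed.

Lemma sact_subproof n z (q : sloc z) : exists p : sloc (n * z),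
  forall c r (Sr : S r) (h : i r * n = i c) b s (Ss : S s) (e : i b = i s * z) x,
  q = sfr Ss e x ->
  p = sfr (submonoidM Sr Ss) (act_deg h e) (act A c b x).
Proof.
have [c [r [Sr h]]] := loc_surj iP n.
elim/sfrP: q => b s Ss e x.
exists (sfr (submonoidM Sr Ss) (act_deg h e) (act A c b x)) => *.
exact: sact_compat.
Qed.

Definition sact n z (q : sloc z) : sloc (n * z) := sval (cid (sact_subproof n q)).

Lemma sactE n z c r (Sr : S r) (h : i r * n = i c)
    b s (Ss : S s) (e : i b = i s * z) (x : A b) :
  sact n (sfr Ss e x) = sfr (submonoidM Sr Ss) (act_deg h e) (act A c b x).
Proof. by rewrite /sact; case: cid => p /= /(_ c r Sr h _ _ Ss e x) ->. Qed.

Fact sact_additive n z : nmod_morphism (@sact n z).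
Proof.
have [c [r [Sr h]]] := loc_surj iP n; split=> [|p q].
  have [b [s [Ss e]]] := loc_surj iP z.
  by rewrite -(sfr0 Ss (esym e)) (sactE Sr h) raddf0 sfr0.
have [b [s [Ss [e [x [x' [-> ->]]]]]]] := common_den p q.
by rewrite sfrD !(sactE Sr h) raddfD sfrD.
Qed.
HB.instance Definition _ n z :=
  GRing.isNmodMorphism.Build (sloc z) (sloc (n * z)) (@sact n z)
    (sact_additive n z).

Fact sact1 z (q : sloc z) : sact 1 q = ecast w (sloc w) (esym (mul1g z)) q.
Proof.
elim/sfrP: q => b s Ss e x.
have e' : i b = i s * (1 * z) by rewrite mul1g.
have h : i 1 * 1 = i 1 by rewrite mulg1.
rewrite (sfr_cast _ _ _ e') (sactE (submonoid1 S) h) -push_erefl.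
by symmetry; apply: sfr_expand.
Qed.

Fact sactM m n z (q : sloc z) :
  sact (m * n) q = ecast w (sloc w) (mulgA m n z) (sact m (sact n q)).
Proof.
have [c [r [Sr h]]] := loc_surj iP m; have [d [t [St k]]] := loc_surj iP n.
have hk : i (r * t) * (m * n) = i (c * d) by rewrite !gmulfM -h -k mulgACA.
elim/sfrP: q => b s Ss e x.
rewrite (sactE St k) (sactE Sr h) (sactE (submonoidM Sr St) hk).
have f : i (c * (d * b)) = i (r * (t * s)) * (m * n * z).
  by rewrite -mulgA (act_deg h (act_deg k e)).
rewrite (sfr_cast _ _ _ f) -!push_erefl.
have g : 1 * (c * (d * b)) = c * d * b by rewrite mul1g mulgA.
have g' : c * d * b = c * (d * b) by rewrite mulgA.
rewrite (push_comp _ _ g') // -(push_comp g' g) ?mul1g //.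
by symmetry; apply: sfr_expand; rewrite mul1g mulgA.
Qed.

(** The localisation [i_! A]; for [i := to_loc S] it is [S^-1 A]. *)
Definition loc_sys : system N :=
  @System N sloc (fun n z => @sact n z) sact1 sactM.

Lemma loc_sys_unit_deg a : i a = i 1 * i a.
Proof. by rewrite gmulf1 mul1g. Qed.

Definition loc_sys_in a (x : A a) : loc_sys (i a) :=
  sfr (submonoid1 S) (loc_sys_unit_deg a) x.

Fact loc_sys_in_additive a : nmod_morphism (@loc_sys_in a).
Proof. by split=> [|x y]; rewrite /loc_sys_in ?sfr0 // -sfrD. Qed.
HB.instance Definition _ a :=
  GRing.isNmodMorphism.Build (A a) (loc_sys (i a)) (@loc_sys_in a)
    (loc_sys_in_additive a).

Fact loc_sys_in_act r a (x : A a) :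
  loc_sys_in (act A r a x) = act (pull i loc_sys) r a (loc_sys_in x).
Proof.
have h : i 1 * i r = i r by rewrite gmulf1 mul1g.
rewrite /= /push /= (sactE (submonoid1 S) h).
have e : i (r * a) = i (1 * 1) * i (r * a) by rewrite mulg1 gmulf1 mul1g.
rewrite (sfr_cast _ _ _ e) /loc_sys_in.
by apply: sfr_den; rewrite mulg1.
Qed.

Definition loc_sys_unit : sys_hom A (pull i loc_sys) :=
  @SysHom M A (pull i loc_sys) (fun a => @loc_sys_in a) loc_sys_in_act.

Section Adjoint.

Variables (B : system N) (f : sys_hom A (pull i B)).

Lemma inv_deg w z b s : w * i s = 1 -> i b = i s * z -> w * i b = z.
Proof. by move=> ws ->; rewrite mulgA ws mul1g. Qed.

Lemma sys_map_pull_push r a b (e : r * a = b) (e' : i r * i a = i b) (x : A a) :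
  f b (push e x) = push e' (f a x : B (i a)).
Proof.
rewrite sys_map_push; case: b / e e' => e'.
exact: (@push_eq N B (i r) (i r) _ _ (esym (gmulfM (s := i) r a)) e').
Qed.

Lemma adjoint_compat z b s (Ss : S s) (e : i b = i s * z) (x : A b)
    b' s' (Ss' : S s') (e' : i b' = i s' * z) (x' : A b') w w'
    (ws : w * i s = 1) (ws' : w' * i s' = 1) :
  sfr Ss e x = sfr Ss' e' x' ->
  push (inv_deg ws e) (f b x : B (i b)) = push (inv_deg ws' e') (f b' x' : B (i b')).
Proof.
move=> /sfrE[u [d [g [g' [Su k]]]]].
have [v vu] := loc_unit iP Su.
have gi : i (u * s') * i b = i d by rewrite -g [RHS]gmulfM.
have gi' : i (u * s) * i b' = i d by rewrite -g' [RHS]gmulfM.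
have dz : v * w * w' * i d = z.
  rewrite -gi e gmulfM [LHS](AC (3*(2*2)) ((1*4)*(2*6)*(3*5)*7)) /=.
  by rewrite vu ws ws' !mul1g.
rewrite -(push_comp gi dz); last first.
  by rewrite gmulfM [LHS](AC (3*2) ((1*4)*(3*5)*2)) /= vu ws' !mul1g.
rewrite -(push_comp gi' dz); last first.
  by rewrite gmulfM [LHS](AC (3*2) ((1*4)*(2*5)*3)) /= vu ws !mul1g.
by rewrite -!sys_map_pull_push k.
Qed.

Lemma adjoint_subproof z (q : loc_sys z) : exists y : B z,
  forall b s (Ss : S s) (e : i b = i s * z) x w (ws : w * i s = 1),
  q = sfr Ss e x -> y = push (inv_deg ws e) (f b x : B (i b)).
Proof.
elim/sfrP: q => b s Ss e x; have [w ws] := loc_unit iP Ss.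
exists (push (inv_deg ws e) (f b x : B (i b))) => *.
exact: adjoint_compat.
Qed.

Definition adjoint_map z (q : loc_sys z) : B z := sval (cid (adjoint_subproof q)).

(** [x / s |-> (1 / i s)_* (f x)] *)
Lemma adjoint_mapE z b s (Ss : S s) (e : i b = i s * z) (x : A b)
    w (ws : w * i s = 1) :
  adjoint_map (sfr Ss e x) = push (inv_deg ws e) (f b x : B (i b)).
Proof. by rewrite /adjoint_map; case: cid => y /= /(_ _ _ Ss e x w ws) ->. Qed.

Fact adjoint_map_additive z : nmod_morphism (@adjoint_map z).
Proof.
split=> [|p q].
  have [b [s [Ss e]]] := loc_surj iP z; have [w ws] := loc_unit iP Ss.
  by rewrite -(sfr0 Ss (esym e)) (adjoint_mapE _ _ _ ws) !raddf0.
have [b [s [Ss [e [x [x' [-> ->]]]]]]] := common_den p q.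
have [w ws] := loc_unit iP Ss.
by rewrite sfrD !(adjoint_mapE _ _ _ ws) !raddfD.
Qed.
HB.instance Definition _ z :=
  GRing.isNmodMorphism.Build (loc_sys z) (B z) (@adjoint_map z)
    (adjoint_map_additive z).

Fact adjoint_map_act n z (q : loc_sys z) :
  adjoint_map (act loc_sys n z q) = act B n z (adjoint_map q).
Proof.
have [c [r [Sr h]]] := loc_surj iP n; have [v vr] := loc_unit iP Sr.
elim/sfrP: q => b s Ss e x; have [w ws] := loc_unit iP Ss.
have vw : v * w * i (r * s) = 1.
  by rewrite gmulfM mulgACA vr ws mulg1.
rewrite /= (sactE Sr h) (adjoint_mapE _ _ _ vw) (adjoint_mapE _ _ _ ws).
have g : i c * i b = i (c * b) by rewrite gmulfM.
rewrite -!push_erefl (sys_map_pull_push _ g); apply: push_comm.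
by rewrite -h [LHS](AC (2*2) ((1*3)*4*2)) /= vr mul1g.
Qed.

(** The morphism [i_! A -> B] adjoint to [f : A -> i^* B]. *)
Definition adjoint : sys_hom loc_sys B :=
  @SysHom N loc_sys B (fun z => @adjoint_map z) adjoint_map_act.

Lemma adjoint_unit : sys_hom_comp (pull_map i adjoint) loc_sys_unit = f.
Proof.
apply: sys_hom_ext => a x; have w1 : 1 * i 1 = 1 by rewrite gmulf1 mulg1.
by rewrite /= /loc_sys_in (adjoint_mapE _ _ _ w1) push1.
Qed.

Lemma adjoint_unique (g : sys_hom loc_sys B) :
  sys_hom_comp (pull_map i g) loc_sys_unit = f -> g = adjoint.
Proof.
move=> gf; apply: sys_hom_ext => z; elim/sfrP=> b s Ss e x.
have [w ws] := loc_unit iP Ss.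
rewrite /= (adjoint_mapE _ _ _ ws) -gf /= -sys_map_push; congr (g z _).
have h : i s * w = i 1 by rewrite gmulf1 mulgC.
rewrite /push /= /loc_sys_in (sactE Ss h).
have e' : i (1 * b) = i (s * 1) * z by rewrite mul1g mulg1.
rewrite (sfr_cast _ _ _ e') -push_erefl.
by apply: sfr_expand; rewrite mul1g mulg1.
Qed.

End Adjoint.

End LocSystem.

(** The data of a monoid scheme that the category of systems over it depends
    on: the poset of points, the stalks, and for [y <= x] the map of stalks,
    which is the localisation at [mdens]. Being locally affine is not recorded;
    it plays no role in the definition of these systems. *)
Record mscheme := MScheme {
  mdisp : Order.disp_t;
  points :> porderType mdisp;
  stalk : points -> comMonoidType;
  mres : forall x y, (y <= x)%O -> UMagmaMorphism.type (stalk x) (stalk y);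
  mdens : forall x y, (y <= x)%O -> submonoid (stalk x);
  mres_loc : forall x y (yx : (y <= x)%O), is_localisation (mdens yx) (mres yx);
  mres_id : forall x (xx : (x <= x)%O) a, mres xx a = a;
  mres_comp : forall x y z (yx : (y <= x)%O) (zy : (z <= y)%O) (zx : (z <= x)%O) a,
    mres zy (mres yx a) = mres zx a }.

Record scheme_sys (X : mscheme) := SchemeSys {
  ssys :> forall x : X, system (stalk x);
  salpha : forall (x y : X) (yx : (y <= x)%O),
    sys_hom (ssys x) (pull (mres yx) (ssys y));
  salpha_id : forall (x : X) (xx : (x <= x)%O) a (v : ssys x a),
    salpha xx a v = ecast b (ssys x b) (esym (mres_id xx a)) v;
  salpha_comp : forall (x y z : X) (yx : (y <= x)%O) (zy : (z <= y)%O)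
      (zx : (z <= x)%O) a (v : ssys x a),
    salpha zx a v =
    ecast b (ssys z b) (mres_comp yx zy zx a) (salpha zy (mres yx a) (salpha yx a v));
  salpha_iso : forall (x y : X) (yx : (y <= x)%O),
    is_iso (C := sys_cat (stalk y)) (adjoint (mres_loc yx) (salpha yx)) }.

Record scheme_hom (X : mscheme) (A B : scheme_sys X) := SchemeHom {
  scheme_map :> forall x : X, sys_hom (A x) (B x);
  scheme_map_alpha : forall (x y : X) (yx : (y <= x)%O),
    sys_hom_comp (salpha B yx) (scheme_map x) =
    sys_hom_comp (pull_map (mres yx) (scheme_map y)) (salpha A yx) }.

Lemma scheme_hom_ext (X : mscheme) (A B : scheme_sys X) (f g : scheme_hom A B) :
  (forall x a v, f x a v = g x a v) -> f = g.
Proof.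
case: f g => [f Hf] [g Hg] /= fg.
have fgE : f = g.
  by apply: functional_extensionality_dep => x; apply: sys_hom_ext => a v; apply: fg.
by subst g; rewrite (Prop_irrelevance Hf Hg).
Qed.

Section SchemeCategory.

Variable X : mscheme.

Fact scheme_hom_id_alpha (A : scheme_sys X) (x y : X) (yx : (y <= x)%O) :
  sys_hom_comp (salpha A yx) (sys_hom_id (A x)) =
  sys_hom_comp (pull_map (mres yx) (sys_hom_id (A y))) (salpha A yx).
Proof. exact: sys_hom_ext. Qed.

Definition scheme_hom_id (A : scheme_sys X) : scheme_hom A A :=
  @SchemeHom X A A (fun x => sys_hom_id (A x)) (scheme_hom_id_alpha A).

Fact scheme_hom_comp_alpha (A B C : scheme_sys X) (g : scheme_hom B C)
    (f : scheme_hom A B) (x y : X) (yx : (y <= x)%O) :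
  sys_hom_comp (salpha C yx) (sys_hom_comp (g x) (f x)) =
  sys_hom_comp (pull_map (mres yx) (sys_hom_comp (g y) (f y))) (salpha A yx).
Proof.
rewrite sys_hom_compA scheme_map_alpha -sys_hom_compA scheme_map_alpha.
exact: sys_hom_ext.
Qed.

Definition scheme_hom_comp (A B C : scheme_sys X) (g : scheme_hom B C)
    (f : scheme_hom A B) : scheme_hom A C :=
  @SchemeHom X A C (fun x => sys_hom_comp (g x) (f x)) (scheme_hom_comp_alpha g f).

Fact scheme_hom_comp_idl (A B : scheme_sys X) (f : scheme_hom A B) :
  scheme_hom_comp (scheme_hom_id B) f = f.
Proof. exact: scheme_hom_ext. Qed.

Fact scheme_hom_comp_idr (A B : scheme_sys X) (f : scheme_hom A B) :
  scheme_hom_comp f (scheme_hom_id A) = f.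
Proof. exact: scheme_hom_ext. Qed.

Fact scheme_hom_compA (A B C D : scheme_sys X) (h : scheme_hom C D)
    (g : scheme_hom B C) (f : scheme_hom A B) :
  scheme_hom_comp h (scheme_hom_comp g f) = scheme_hom_comp (scheme_hom_comp h g) f.
Proof. exact: scheme_hom_ext. Qed.

Definition scheme_cat : category :=
  Category scheme_hom_comp_idl scheme_hom_comp_idr scheme_hom_compA.

End SchemeCategory.

Section Spec.

Variable M : comMonoidType.
Implicit Types p q : prime_ideal M.

Lemma prime_complM p a b :
  ~ ideal_set p a -> ~ ideal_set p b -> ~ ideal_set p (a * b).
Proof.
by have /asboolP[_ _ pP] := prime_idealP p => pa pb /pP /(_ pb).
Qed.

Definition prime_compl p : submonoid M :=
  @Submonoid M (fun a => ~ ideal_set p a)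
    (ideal_proper (asboolW (prime_idealP p))) (@prime_complM p).

Lemma prime_complS p q : (q <= p)%O ->
  forall a, prime_compl p a -> prime_compl q a.
Proof. by move=> /asboolP qp a pa qa; apply: pa; apply: qp. Qed.

Definition loc_at p : comMonoidType := loc (prime_compl p).

Definition loc_at_map p q (qp : (q <= p)%O) :
    UMagmaMorphism.type (loc_at p) (loc_at q) :=
  loc_map (prime_complS qp).

Lemma loc_at_map_id p (pp : (p <= p)%O) (x : loc_at p) : loc_at_map pp x = x.
Proof.
elim/fracW: x => a s; rewrite /= loc_map_frac; congr frac.
exact/val_inj.
Qed.

Lemma loc_at_map_comp p q r (qp : (q <= p)%O) (rq : (r <= q)%O) (rp : (r <= p)%O)
  (x : loc_at p) : loc_at_map rq (loc_at_map qp x) = loc_at_map rp x.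
Proof.
elim/fracW: x => a s; rewrite /= !loc_map_frac; congr frac.
exact/val_inj.
Qed.

(** For [q] included in [p] the map [M_p -> M_q] is the localisation of [M_p]
    at the image of the complement of [q]. *)
Definition spec : mscheme :=
  @MScheme spec_display (prime_ideal M) loc_at loc_at_map
    (fun p q qp => loc_den (prime_compl p) (prime_compl q))
    (fun p q qp => loc_map_localisation (prime_complS qp))
    loc_at_map_id loc_at_map_comp.

End Spec.

(* Main.v *)
From HB Require Import structures.
From mathcomp Require Import all_boot order ssralg boolp classical_sets.
Require Import Defs.

(** The nonunits of [M] form the largest prime ideal [m] of [M], so [Spec M] has
    a largest point, and [M -> M_m] is an isomorphism. A system over [Spec M]
    is determined by its stalk at [m], since every other stalk is, by
    definition, a localisation of that one. Hence evaluation at [m], read as a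
    system over [M], is an equivalence.

    The argument runs through universal properties. Say that
    [f : A -> i^* B] is [universal] when every morphism from [A] to some [i^* C]
    factors uniquely through [f]; this means that the adjoint [i_! A -> B] is an
    isomorphism ([universalP]). Universal morphisms compose, and they cancel on
    the left ([universal_comp], [universal_cancel]); this replaces any comparison
    of iterated fractions.

    For a system [A] over a scheme with a largest point [t], the structure
    morphisms out of [A_t] give, for each point [x], a universal morphism over
    [M -> O_x] from the evaluation of [A] at [t] to [A_x]
    ([top_arrow_universal]). Uniqueness of factorisations makes evaluation
    faithful, their existence makes it full. Conversely the localisations of a
    system over [M] at all points form a system over the scheme
    ([loc_scheme_sys]), the isomorphism condition being the cancellation
    property; its evaluation at [t] is the given system, because the
    denominators at [t] are units ([loc_sys_unit_iso]). *)

Set Implicit Arguments.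
Unset Strict Implicit.
Unset Printing Implicit Defensive.

Import GRing.Theory.

Local Open Scope group_scope.

(** * Equivalences from fully faithful functors *)

Lemma equivalent_fully_faithful (C D : category) (G : functor D C) :
  (forall (X Y : D) (f g : hom X Y), fmap G f = fmap G g -> f = g) ->
  (forall (X Y : D) (g : hom (G X) (G Y)), exists f : hom X Y, fmap G f = g) ->
  (forall Z : C, exists (X : D) (e : hom (G X) Z), is_iso e) ->
  equivalent C D.
Proof.
move=> faith full esurj.
have liftP (X Y : D) (g : hom (G X) (G Y)) : {f : hom X Y | fmap G f = g}.
  exact: cid (full X Y g).
pose lift X Y g := sval (liftP X Y g).
have liftE X Y g : fmap G (lift X Y g) = g by exact: (svalP (liftP X Y g)).
pose fo Z := sval (cid (esurj Z)).
have eP Z : {e : hom (G (fo Z)) Z & {e' : hom Z (G (fo Z)) |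
    comp e' e = idm _ /\ comp e e' = idm _}}.
  have [e /cid[e' ee']] := cid (svalP (cid (esurj Z))).
  by exists e, e'.
pose e Z := projT1 (eP Z); pose e' Z := sval (projT2 (eP Z)).
have e'e Z : comp (e' Z) (e Z) = idm _ by have [] := svalP (projT2 (eP Z)).
have ee' Z : comp (e Z) (e' Z) = idm _ by have [] := svalP (projT2 (eP Z)).
pose fm Y Z (f : hom Y Z) := lift _ _ (comp (e' Z) (comp f (e Y))).
have fm_id Z : fm _ _ (idm Z) = idm (fo Z).
  by apply: faith; rewrite liftE comp_idl e'e fmap_id.
have fm_comp X Y Z (g : hom Y Z) (f : hom X Y) :
    fm _ _ (comp g f) = comp (fm _ _ g) (fm _ _ f).
  apply: faith; rewrite fmap_comp !liftE.
  by rewrite -!compA [comp (e Y) _]compA ee' comp_idl.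
exists (@Functor C D fo fm fm_id fm_comp), G; split.
  exists e; split=> [Z|Y Z f] /=; first by exists (e' Z).
  by rewrite liftE compA ee' comp_idl.
exists (fun X => lift (fo (G X)) X (e (G X))); split=> [X|X Y f] /=.
  exists (lift X (fo (G X)) (e' (G X))).
  by split; apply: faith; rewrite fmap_comp !liftE fmap_id.
apply: faith; rewrite !fmap_comp !liftE.
by rewrite compA ee' comp_idl.
Qed.

(** * Transport between equal degrees *)

(** The degrees [j (i a)] and [l a], for [j \o i] pointwise equal to [l], are
    equal but not convertible. Naming the transport lets one rule merge
    successive transports and another compare any two with the same ends. *)
Definition cast_map (M : comMonoidType) (A : system M) a b (e : a = b)
  (x : A a) : A b := ecast w (A w) e x.

Lemma cast_map_additive (M : comMonoidType) (A : system M) a b (e : a = b) :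
  nmod_morphism (cast_map e : A a -> A b).
Proof. by case: b / e. Qed.

HB.instance Definition _ (M : comMonoidType) (A : system M) a b (e : a = b) :=
  GRing.isNmodMorphism.Build (A a) (A b) (cast_map e) (cast_map_additive A e).

Section Cast.

Variables (M : comMonoidType) (A B : system M).

Lemma cast_trans a b c (e : a = b) (f : b = c) (x : A a) :
  cast_map f (cast_map e x) = cast_map (etrans e f) x.
Proof. by case: c / f. Qed.

Lemma cast_irr a b (e f : a = b) (x : A a) : cast_map e x = cast_map f x.
Proof. by rewrite (eq_irrelevance e f). Qed.

Lemma castK a b (e : a = b) : cancel (cast_map e : A a -> A b) (cast_map (esym e)).
Proof. by case: b / e. Qed.

Lemma castVK a b (e : a = b) : cancel (cast_map (esym e) : A b -> A a) (cast_map e).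
Proof. by case: b / e. Qed.

Lemma sys_map_cast (f : sys_hom A B) a b (e : a = b) (x : A a) :
  f b (cast_map e x) = cast_map e (f a x).
Proof. by case: b / e. Qed.

End Cast.

Lemma pull_cast_map (M N : comMonoidType) (phi : UMagmaMorphism.type M N)
    (A : system N) a b (e : a = b) (x : A (phi a)) :
  cast_map e (x : pull phi A a) = cast_map (congr1 phi e) x.
Proof. by case: b / e. Qed.

Section Bijective.

Variables (M : comMonoidType) (A B : system M) (f : sys_hom A B).

Lemma sys_iso_bij : (forall a, injective (f a)) ->
  (forall a y, exists x, f a x = y) -> is_iso (C := sys_cat M) f.
Proof.
move=> finj fsurj; pose gP a y := cid (fsurj a y).
pose g a y := sval (gP a y).
have gK a : cancel (g a) (f a) by move=> y; exact: svalP (gP a y).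
have fK a : cancel (f a) (g a) by move=> x; apply: finj; rewrite gK.
have g_add a : nmod_morphism (g a).
  by split=> [|x y]; apply: (can_inj (fK a)); rewrite (raddf0, raddfD) !gK ?raddf0.
pose ga a : {additive B a -> A a} :=
  HB.pack (g a) (GRing.isNmodMorphism.Build (B a) (A a) _ (g_add a)).
have ga_act r a (x : B a) : ga (r * a) (act B r a x) = act A r a (ga a x).
  by apply: (can_inj (fK _)); rewrite /= gK sys_map_act gK.
exists (SysHom ga_act).
by split; apply: sys_hom_ext => a x /=; rewrite ?fK ?gK.
Qed.

Lemma sys_iso_cancel : is_iso (C := sys_cat M) f ->
  exists2 g : sys_hom B A,
    (forall a, cancel (f a) (g a)) & (forall a, cancel (g a) (f a)).
Proof.
move=> [g [gf fg]]; exists g => a x.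
  exact: (congr1 (fun h : sys_hom A A => h a x) gf).
exact: (congr1 (fun h : sys_hom B B => h a x) fg).
Qed.

End Bijective.

Lemma pull_push (M N : comMonoidType) (phi : UMagmaMorphism.type M N)
    (A : system N) r a b (e : r * a = b) (e' : phi r * phi a = phi b)
    (x : A (phi a)) :
  push e (x : pull phi A a) = push e' x.
Proof. by case: b / e e' => e'; exact: (@push_eq N A (phi r) (phi r)). Qed.

(** When [j \o i] and [l] agree pointwise, the systems [i^* (j^* D)] and [l^* D]
    are identified by transporting degrees. *)
Section Reindex.

Variables (M N L : comMonoidType) (i : UMagmaMorphism.type M N).
Variables (j : UMagmaMorphism.type N L) (l : UMagmaMorphism.type M L).
Hypothesis jil : forall a, j (i a) = l a.
Variable D : system L.

Lemma pull_merge_act r a (x : pull i (pull j D) a) :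
  cast_map (jil (r * a)) (act (pull i (pull j D)) r a x : D (j (i (r * a)))) =
  act (pull l D) r a (cast_map (jil a) (x : D (j (i a)))).
Proof.
have e1 : 1 * j (i (r * a)) = l (r * a) by rewrite mul1g.
have e3 : 1 * j (i a) = l a by rewrite mul1g.
have e2 : j (i r) * j (i a) = j (i (r * a)) by rewrite !gmulfM.
rewrite /cast_map (push_cast _ e1) (push_cast _ e3) /= (pull_push _ e2).
by apply: push_comm; rewrite mul1g mulg1 jil.
Qed.

Definition pull_merge : sys_hom (pull i (pull j D)) (pull l D) :=
  @SysHom M (pull i (pull j D)) (pull l D)
    (fun a => cast_map (jil a) : {additive D (j (i a)) -> D (l a)}) pull_merge_act.

Lemma pull_split_act r a (x : pull l D a) :
  cast_map (esym (jil (r * a))) (act (pull l D) r a x : D (l (r * a))) =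
  act (pull i (pull j D)) r a (cast_map (esym (jil a)) (x : D (l a))).
Proof.
have {1}-> : x = pull_merge a (cast_map (esym (jil a)) (x : D (l a))).
  by rewrite /= castVK.
by rewrite -sys_map_act /= castK.
Qed.

Definition pull_split : sys_hom (pull l D) (pull i (pull j D)) :=
  @SysHom M (pull l D) (pull i (pull j D))
    (fun a => cast_map (esym (jil a)) : {additive D (l a) -> D (j (i a))})
    pull_split_act.

End Reindex.

Section PullId.

Variables (M : comMonoidType) (phi : UMagmaMorphism.type M M).
Hypothesis phiE : forall a, phi a = a.
Variable A : system M.

Lemma pull_of_id_act r a (x : A a) :
  cast_map (esym (phiE (r * a))) (act A r a x) =
  act (pull phi A) r a (cast_map (esym (phiE a)) x).
Proof.
have e1 : 1 * (r * a) = phi (r * a) by rewrite mul1g phiE.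
have e2 : 1 * a = phi a by rewrite mul1g phiE.
rewrite /cast_map (push_cast _ e1) (push_cast _ e2) /=.
have e4 : phi r * phi a = phi (r * a) by rewrite gmulfM.
transitivity (push e4 (push e2 x)); last exact: push_eq.
by rewrite -push_erefl; apply: push_comm; rewrite mul1g mulg1 phiE.
Qed.

Definition pull_of_id : sys_hom A (pull phi A) :=
  @SysHom M A (pull phi A)
    (fun a => cast_map (esym (phiE a)) : {additive A a -> A (phi a)})
    pull_of_id_act.

End PullId.

(** * Universal morphisms over a monoid homomorphism *)

(** [B] is [i_! A] by its universal property. Equations are stated on elements,
    so that no composition of pullback functors has to be formed. *)
Definition universal (M N : comMonoidType) (i : UMagmaMorphism.type M N)
    (A : system M) (B : system N) (f : sys_hom A (pull i B)) : Prop :=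
  forall (C : system N) (g : sys_hom A (pull i C)),
  exists2 h : sys_hom B C, (forall a x, h (i a) (f a x) = g a x) &
    forall h' : sys_hom B C, (forall a x, h' (i a) (f a x) = g a x) -> h' = h.

Section Universal.

Variables (M N : comMonoidType) (i : UMagmaMorphism.type M N).
Variables (A : system M) (B : system N) (f : sys_hom A (pull i B)).

Lemma universal_ext (C : system N) (h h' : sys_hom B C) : universal f ->
  (forall a x, h (i a) (f a x) = h' (i a) (f a x)) -> h = h'.
Proof.
move=> fU hh'; have [k _ kU] := fU C (sys_hom_comp (pull_map i h) f).
by rewrite (kU h) // (kU h') // => a x; rewrite -hh'.
Qed.

Variables (S : submonoid M) (iP : is_localisation S i).

Lemma adjointE a x : adjoint iP f (i a) (loc_sys_unit iP A a x) = f a x.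
Proof. by have := congr1 (fun h : sys_hom _ _ => h a x) (adjoint_unit iP f). Qed.

End Universal.

Lemma universal_unit (M N : comMonoidType) (S : submonoid M)
    (i : UMagmaMorphism.type M N) (iP : is_localisation S i) (A : system M) :
  universal (loc_sys_unit iP A).
Proof.
move=> C g; exists (adjoint iP g) => [a x|h hg]; first exact: adjointE.
apply: adjoint_unique; apply: sys_hom_ext => a x; exact: hg.
Qed.

Section UniversalIso.

Variables (M N : comMonoidType) (i : UMagmaMorphism.type M N).
Variables (S : submonoid M) (iP : is_localisation S i).
Variables (A : system M) (B : system N) (f : sys_hom A (pull i B)).

(** Both [f] and the unit [A -> i^* i_! A] are then universal, and two universal
    morphisms with the same source have canonically isomorphic targets. *)
Lemma universalP : universal f <-> is_iso (C := sys_cat N) (adjoint iP f).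
Proof.
split=> [fU | /sys_iso_cancel[h hK Kh] C g].
  have [h hf _] := fU _ (loc_sys_unit iP A).
  exists h; split; [apply: (universal_ext (@universal_unit _ _ _ _ iP A))|
    apply: (universal_ext fU)] => a x.
    by rewrite /= adjointE hf.
  by rewrite /= hf adjointE.
have hf a x : h (i a) (f a x) = loc_sys_unit iP A a x.
  by rewrite -(adjointE f iP) hK.
exists (sys_hom_comp (adjoint iP g) h) => [a x|k kf].
  by rewrite /= hf adjointE.
have kE : sys_hom_comp k (adjoint iP f) = adjoint iP g.
  apply: (universal_ext (@universal_unit _ _ _ _ iP A)) => a x.
  by rewrite /= !adjointE kf.
by rewrite -kE; apply: sys_hom_ext => z y; rewrite /= Kh.
Qed.

End UniversalIso.

Section UniversalComp.

Variables (M N L : comMonoidType) (i : UMagmaMorphism.type M N).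
Variables (j : UMagmaMorphism.type N L) (l : UMagmaMorphism.type M L).
Hypothesis jil : forall a, j (i a) = l a.
Variables (A : system M) (B : system N) (C : system L).
Variables (f : sys_hom A (pull i B)) (g : sys_hom B (pull j C)).
Variable k : sys_hom A (pull l C).
Hypothesis kE : forall a x,
  k a x = cast_map (jil a) (g (i a) (f a x) : C (j (i a))).
Hypothesis fU : universal f.

Let kE' a x :
  g (i a) (f a x) = cast_map (esym (jil a)) (k a x : C (l a)).
Proof. by rewrite kE castK. Qed.

(** [j_! (i_! A) = (j i)_! A]: factor a morphism out of [A] first through [f],
    then through [g]. *)
Lemma universal_comp : universal g -> universal k.
Proof.
move=> gU D k'.
have [g' g'f _] := fU (sys_hom_comp (pull_split jil D) k').
have [h hg hU] := gU D g'.
exists h => [a x|h' h'k].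
  by rewrite kE sys_map_cast hg g'f /= castVK.
apply: hU => b y.
have -> : g' = sys_hom_comp (pull_map j h') g; last by [].
apply: (universal_ext fU) => a x.
by rewrite g'f /= -h'k kE' sys_map_cast.
Qed.

(** A morphism out of [B] is the same as one out of [A], because [f] is
    universal, and hence the same as one out of [C], because [k] is. *)
Lemma universal_cancel : universal k -> universal g.
Proof.
move=> kU D g'.
have [h hk hU] := kU D
  (sys_hom_comp (pull_merge jil D) (sys_hom_comp (pull_map i g') f)).
have hgE : sys_hom_comp (pull_map j h) g = g'.
  apply: (universal_ext fU) => a x.
  by rewrite /= kE' sys_map_cast hk /= castK.
exists h => [b y|h' h'g]; first by rewrite -hgE.
by apply: hU => a x; rewrite kE sys_map_cast h'g.
Qed.

End UniversalComp.

Section LocalisationUnits.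

Variables (M N : comMonoidType) (S : submonoid M).
Variables (i : UMagmaMorphism.type M N) (iP : is_localisation S i).

(** Localising adds nothing to a system that already lives over [N]: in it each
    [s] in [S] acts invertibly, so the fraction [x / s] is a value of [B]. *)
Lemma universal_pull (B : system N) : universal (sys_hom_id (pull i B)).
Proof.
apply/(universalP iP)/sys_iso_bij => z.
  move=> p q; have [b [s [Ss [e [x [x' [-> ->]]]]]]] := common_den iP p q.
  have [w ws] := loc_unit iP Ss.
  rewrite /= !(adjoint_mapE _ _ _ _ _ ws) /= => pxx'; congr sfr.
  have := congr1 (push (esym e)) pxx'.
  by rewrite !(push_comp _ _ (mul1g (i b))) 1?mulgC // !push1.
move=> y; have [b [s [Ss e]]] := loc_surj iP z; have [w ws] := loc_unit iP Ss.
(* [y = (s_* y) / s], where [s] clears the denominator of the degree of [y] *)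
exists (sfr Ss (esym e) (push e y : pull i B b)).
rewrite /= (adjoint_mapE _ _ _ _ _ ws) /=.
by rewrite (push_comp _ _ (mul1g z)) // push1.
Qed.

(** When [S] consists of units, [x / s] is already the element [(s^-1)_* x]. *)
Lemma loc_sys_unit_iso (A : system M) :
  (forall s, S s -> exists w, w * s = 1) ->
  is_iso (C := sys_cat M) (loc_sys_unit iP A).
Proof.
move=> Sinv; apply: sys_iso_bij => a.
  move=> x x' /sfrE[u [c [f [f' [Su]]]]]; have [w wu] := Sinv u Su.
  have wc : w * c = a by rewrite -f mulg1 mulgA wu mul1g.
  move/(congr1 (push wc)).
  by rewrite !(push_comp _ _ (mul1g a)) ?mulg1 // !push1.
elim/sfrP=> b s Ss e x; have [w ws] := Sinv s Ss.
have [|u Su h] := loc_eq iP (a := b) (b := s * a); first by rewrite e gmulfM.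
have [v vu] := Sinv u Su.
have wb : w * b = a.
  by rewrite -[b]mul1g -vu -(mulgA v) h (mulgA v) vu mul1g mulgA ws mul1g.
exists (push wb x).
by symmetry; apply: sfr_expand; rewrite ws.
Qed.

End LocalisationUnits.

(** * Schemes whose stalks are localisations of one monoid *)

Section LocalisedScheme.

Variables (M : comMonoidType) (X : mscheme) (S : X -> submonoid M).
Variable j : forall x : X, UMagmaMorphism.type M (stalk x).
Hypothesis jP : forall x : X, is_localisation (S x) (j x).
Hypothesis j_res : forall (x y : X) (yx : (y <= x)%O) a, mres yx (j x a) = j y a.

(** ** The system of localisations of a system over the base monoid *)

Section Sheafify.

Variable A : system M.

Let Aloc (x : X) : system (stalk x) := loc_sys (jP x) A.
Let eta (x : X) : sys_hom A (pull (j x) (Aloc x)) := loc_sys_unit (jP x) A.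
Let etaU (x : X) : universal (eta x) := @universal_unit _ _ _ _ (jP x) A.

(** The universal property of [Aloc x] turns the unit at [y] into the structure
    morphism; [alpha_eta] below is all that is used of it. *)
Let alpha (x y : X) (yx : (y <= x)%O) : sys_hom (Aloc x) (pull (mres yx) (Aloc y)) :=
  adjoint (jP x) (sys_hom_comp (pull_split (j_res yx) (Aloc y)) (eta y)).

Let alpha_eta (x y : X) (yx : (y <= x)%O) a (v : A a) :
  alpha yx (j x a) (eta x a v) =
  cast_map (esym (j_res yx a)) (eta y a v : Aloc y (j y a)).
Proof. exact: adjointE. Qed.

(** The two coherence conditions equate morphisms out of a localisation, so it
    is enough to compare them on the unit; there only transports of degree
    remain. *)
Fact loc_scheme_sys_id (x : X) (xx : (x <= x)%O) a (v : Aloc x a) :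
  alpha xx a v = ecast b (Aloc x b) (esym (mres_id xx a)) v.
Proof.
have -> : alpha xx = pull_of_id (mres_id xx) (Aloc x).
  apply: (universal_ext (@etaU x)) => {}a {}v.
  by rewrite alpha_eta; exact: (@cast_irr _ (Aloc x)).
by [].
Qed.

Fact loc_scheme_sys_comp (x y z : X) (yx : (y <= x)%O) (zy : (z <= y)%O)
    (zx : (z <= x)%O) a (v : Aloc x a) :
  alpha zx a v =
  ecast b (Aloc z b) (mres_comp yx zy zx a) (alpha zy (mres yx a) (alpha yx a v)).
Proof.
have -> : alpha zx = sys_hom_comp (pull_merge (mres_comp yx zy zx) (Aloc z))
    (sys_hom_comp (pull_map (mres yx) (alpha zy)) (alpha yx)).
  apply: (universal_ext (@etaU x)) => {}a {}v.
  rewrite -[RHS]/(cast_map (mres_comp yx zy zx (j x a))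
    (alpha zy _ (alpha yx _ (eta x a v)) : Aloc z (mres zy (mres yx (j x a))))).
  rewrite !alpha_eta sys_map_cast alpha_eta.
  by rewrite pull_cast_map !cast_trans; exact: (@cast_irr _ (Aloc z)).
by [].
Qed.

(** The units at [x] and at [y] are universal, so [universal_cancel] applies to
    the factorisation of the second through the first. *)
Fact loc_scheme_sys_iso (x y : X) (yx : (y <= x)%O) :
  is_iso (C := sys_cat (stalk y)) (adjoint (mres_loc yx) (alpha yx)).
Proof.
apply/universalP/(universal_cancel (jil := j_res yx) (f := eta x) (k := eta y)) => //.
by move=> a v; rewrite alpha_eta castVK.
Qed.

Definition loc_scheme_sys : scheme_sys X :=
  SchemeSys loc_scheme_sys_id loc_scheme_sys_comp loc_scheme_sys_iso.

End Sheafify.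

(** ** Evaluation at a largest point *)

Variable t : X.
Hypothesis tmax : forall x : X, (x <= t)%O.

Section TopArrow.

Variable A : scheme_sys X.

(** The structure morphism from [A_t] to [A_x], read over the base monoid: the
    evaluation of [A] at [t] pulls back along [M -> O_t], and [M -> O_x] factors
    through [O_t]. *)
Definition top_arrow (x : X) : sys_hom (pull (j t) (A t)) (pull (j x) (A x)) :=
  sys_hom_comp (pull_merge (j_res (tmax x)) (A x))
    (pull_map (j t) (salpha A (tmax x))).

(** This is where the isomorphism condition of a system over [X] enters: it makes
    the second of the two composed morphisms universal. *)
Lemma top_arrow_universal (x : X) : universal (top_arrow x).
Proof.
apply: (universal_comp (jil := j_res (tmax x)) (f := sys_hom_id _)
  (g := salpha A (tmax x))) => //.
  exact: (universal_pull (jP t)).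
exact/(universalP (mres_loc (tmax x)))/salpha_iso.
Qed.

Lemma top_arrowE (x : X) a (v : A t (j t a)) :
  top_arrow x a v =
  cast_map (j_res (tmax x) a)
    (salpha A (tmax x) (j t a) v : A x (mres (tmax x) (j t a))).
Proof. by []. Qed.

Lemma top_arrow_top a (v : A t (j t a)) : top_arrow t a v = v.
Proof.
rewrite top_arrowE salpha_id.
rewrite -[ecast _ _ _ _]/(cast_map (esym (mres_id (tmax t) (j t a))) v) cast_trans.
exact: (@cast_irr _ (A t) _ _ _ erefl).
Qed.

Lemma top_arrow_salpha (x y : X) (yx : (y <= x)%O) a (v : A t (j t a)) :
  salpha A yx (j x a) (top_arrow x a v) =
  cast_map (esym (j_res yx a)) (top_arrow y a v : A y (j y a)).
Proof.
rewrite !top_arrowE sys_map_cast pull_cast_map (salpha_comp (tmax x) yx (tmax y)).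
rewrite -[ecast _ _ _ _]/(cast_map (mres_comp (tmax x) yx (tmax y) (j t a))
  (salpha A yx _ (salpha A (tmax x) _ v) : A y (mres yx (mres (tmax x) (j t a))))).
by rewrite !cast_trans; exact: (@cast_irr _ (A y)).
Qed.

End TopArrow.

Definition top_sections (A : scheme_sys X) : system M := pull (j t) (A t).

Definition top_sections_map (A B : scheme_sys X) (f : scheme_hom A B) :
    sys_hom (top_sections A) (top_sections B) :=
  pull_map (j t) (f t).

Fact top_sections_id (A : scheme_sys X) :
  top_sections_map (scheme_hom_id A) = sys_hom_id (top_sections A).
Proof. exact: sys_hom_ext. Qed.

Fact top_sections_comp (A B C : scheme_sys X) (g : scheme_hom B C)
    (f : scheme_hom A B) :
  top_sections_map (scheme_hom_comp g f) =
  sys_hom_comp (top_sections_map g) (top_sections_map f).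
Proof. exact: sys_hom_ext. Qed.

Definition top_sections_functor : functor (scheme_cat X) (sys_cat M) :=
  @Functor (scheme_cat X) (sys_cat M) top_sections top_sections_map
    top_sections_id top_sections_comp.

Section FullyFaithful.

Variables A B : scheme_sys X.

(** A morphism of systems over [X] is determined at [x] by its value at [t],
    since [top_arrow A x] is universal. *)
Lemma top_arrow_nat (f : scheme_hom A B) (x : X) a (v : A t (j t a)) :
  f x (j x a) (top_arrow A x a v) = top_arrow B x a (f t (j t a) v).
Proof.
rewrite !top_arrowE sys_map_cast; congr cast_map.
exact: (esym (congr1 (fun h : sys_hom _ _ => h (j t a) v)
  (scheme_map_alpha f (tmax x)))).
Qed.

Lemma top_sections_faithful (f f' : scheme_hom A B) :
  top_sections_map f = top_sections_map f' -> f = f'.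
Proof.
move=> ff'; have fE x : f x = f' x; last first.
  by apply: scheme_hom_ext => x z y; rewrite fE.
apply: (universal_ext (@top_arrow_universal A x)) => a v.
rewrite !top_arrow_nat; congr (top_arrow B x a _).
exact: (congr1 (fun h : sys_hom _ _ => h a v) ff').
Qed.

(** The factorisations of [top_arrow B x \o g] through [top_arrow A x] commute
    with the structure morphisms because both composites agree after
    [top_arrow A x]. *)
Lemma top_sections_full (g : sys_hom (top_sections A) (top_sections B)) :
  exists f : scheme_hom A B, top_sections_map f = g.
Proof.
pose fP x := cid2 (@top_arrow_universal A x _ (sys_hom_comp (top_arrow B x) g)).
pose f x : sys_hom (A x) (B x) := s2val (fP x).
have fE x a v : f x (j x a) (top_arrow A x a v) = top_arrow B x a (g a v).
  exact: (s2valP (fP x) a v).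
have f_alpha (x y : X) (yx : (y <= x)%O) :
    sys_hom_comp (salpha B yx) (f x) =
    sys_hom_comp (pull_map (mres yx) (f y)) (salpha A yx).
  apply: (universal_ext (@top_arrow_universal A x)) => a v.
  transitivity (salpha B yx (j x a) (f x (j x a) (top_arrow A x a v))) => //.
  by rewrite fE top_arrow_salpha -fE -sys_map_cast -top_arrow_salpha.
exists (SchemeHom f_alpha); apply: sys_hom_ext => a v.
have := fE t a v; rewrite !top_arrow_top; exact.
Qed.

End FullyFaithful.

Hypothesis t_units : forall s, S t s -> exists w, w * s = 1.

(** A system over [M] is recovered, up to the unit of localisation at [t], from
    its system of localisations. *)
Theorem equivalent_top_sections : equivalent (sys_cat M) (scheme_cat X).
Proof.
apply: (equivalent_fully_faithful (G := top_sections_functor)).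
- exact: top_sections_faithful.
- exact: top_sections_full.
move=> A; exists (loc_scheme_sys A).
have [e [eK Ke]] := loc_sys_unit_iso (jP t) A t_units.
by exists e, (loc_sys_unit (jP t) A).
Qed.

End LocalisedScheme.

(** * The affine case *)

Section MaximalIdeal.

Variable M : comMonoidType.

Definition nonunits : set M := [set a | ~ exists w, w * a = 1]%classic.

Lemma nonunits_prime : is_prime_ideal nonunits.
Proof.
split.
- move=> a x xn [w wax]; apply: xn; exists (w * a); by rewrite -mulgA.
- by apply; exists 1; rewrite mulg1.
- move=> a b abn /contrapT[v vb] [w wa]; apply: abn; exists (w * v).
  by rewrite mulgACA wa vb mulg1.
Qed.

Definition maximal_ideal : prime_ideal M := PrimeIdeal (asboolT nonunits_prime).

Lemma maximal_idealP (p : prime_ideal M) : (p <= maximal_ideal)%O.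
Proof.
have /asboolP[pM p1 _] := prime_idealP p.
by apply/asboolP => a pa [w wa]; apply: p1; rewrite -wa; exact: pM.
Qed.

End MaximalIdeal.

Theorem lemma5p6 (M : comMonoidType) (Mfg : finitely_generated M) :
  equivalent (sys_cat M) (scheme_cat (spec M)).
Proof.
apply: (@equivalent_top_sections M (spec M) (@prime_compl M)
  (fun p => to_loc (prime_compl p)) _ _ (maximal_ideal M)).
- by move=> p; exact: to_loc_localisation.
- by move=> p q qp a; exact: loc_map_to_loc.
- exact: maximal_idealP.
- by move=> s /contrapT.
Qed.
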